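(* Let $\widehat{A}=A+\varepsilon B$ be an $n\times n$ dual matrix with $A,B\in\mathbb{R}^{n\times n}$. Then the following conditions are equivalent: (1) the dual core generalized inverse of $\widehat{A}$ exists; (2) $\mathrm{Ind}(A)=1$, and the equation $BA^{\#}A+AXA+AA^{\#}B=B$ is consistent (has a solution $X\in\mathbb{R}^{n\times n}$); (3) $\mathrm{Ind}(A)=1$, and the equation $BA^{+}A+AXA+AA^{+}B=B$ is consistent (has a solution $X\in\mathbb{R}^{n\times n}$); (4) $\mathrm{Ind}(A)=1$, and the equation $BA^{\mathrm{c}}A+AXA+AA^{\mathrm{c}}B=B$ is consistent (has a solution $X\in\mathbb{R}^{n\times n}$). Here $A^{\#}$, $A^{+}$, $A^{\mathrm{c}}$ denote the group inverse, Moore–Penrose inverse and core inverse of $A$, respectively.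
   Context: Dual numbers are $a+\varepsilon a'$ with $a,a'\in\mathbb{R}$ and $\varepsilon\neq 0$, $\varepsilon^2=0$ (i.e. the ring $\mathbb{R}[\varepsilon]/(\varepsilon^2)$). A dual matrix is a matrix over dual numbers, written $\widehat{A}=A+\varepsilon B$ with $A,B$ real; its transpose is $\widehat{A}^{T}=A^{T}+\varepsilon B^{T}$. The dual core generalized inverse (DCGI) of an $n\times n$ dual matrix $\widehat{A}$ is an $n\times n$ dual matrix $\widehat{G}$ with $\widehat{A}\widehat{G}\widehat{A}=\widehat{A}$, $\widehat{A}\widehat{G}^2=\widehat{G}$, $(\widehat{A}\widehat{G})^{T}=\widehat{A}\widehat{G}$; it may or may not exist. For a real square matrix $A$, ''$\mathrm{Ind}(A)=1$'' means $\mathrm{rank}(A^2)=\mathrm{rank}(A)$; in that case the group inverse $A^{\#}$ is the unique real $X$ with $AXA=A$, $XAX=X$, $AX=XA$, and the core inverse $A^{\mathrm{c}}$ is the unique real $X$ with $AXA=A$, $AX^2=X$, $(AX)^{T}=AX$. *)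

(* Defs.v *)
From HB Require Import structures.
From mathcomp Require Import all_boot all_order all_algebra.
From mathcomp Require Import boolp classical_sets reals.

Set Implicit Arguments.
Unset Strict Implicit.
Unset Printing Implicit Defensive.

Import Order.TTheory GRing.Theory Num.Theory.
Import Pdiv.CommonRing Pdiv.RingMonic.
Local Open Scope ring_scope.

(* qpoly replaces a modulus that is constant or not monic by 'X; 'X^2 is monic
   of size 3, so this is R[X]/(X^2), with epsilon the class 'qX of X. *)
Notation dual R := {poly %/ ('X^2 : {poly R})}.

Definition dual_mx (R : realType) (n : nat) (A B : 'M[R]_n) : 'M[dual R]_n :=
  map_mx (qpolyC 'X^2) A + ('qX : dual R) *: map_mx (qpolyC 'X^2) B.

Lemma dual_eps_neq0 (R : realType) : ('qX : dual R) != 0.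
Proof.
apply/eqP => /(congr1 (@polyn _ _)).
by rewrite qpolyXE ?size_polyXn ?monicXn //; apply/eqP; rewrite polyX_eq0.
Qed.

Lemma dual_eps_sqr (R : realType) : ('qX : dual R) ^+ 2 = 0.
Proof.
rewrite /qpolyX -rmorphXn; apply/val_inj => /=.
by rewrite mk_monic_Xn rmodpp ?monicXn.
Qed.

Lemma dual_mx_surj (R : realType) (n : nat) (M : 'M[dual R]_n) :
  exists A B : 'M[R]_n, M = dual_mx A B.
Proof.
exists (map_mx (fun x : dual R => x`_0) M), (map_mx (fun x : dual R => x`_1) M).
apply/matrixP => i j; rewrite !mxE.
have h2 : size (mk_monic ('X^2 : {poly R})) = 3%N.
  by rewrite mk_monic_Xn size_polyXn.
have sM : (size (M i j) <= 2)%N by rewrite -ltnS -h2 size_mk_monic.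
have sXb : (size ('X * ((M i j)`_1)%:P : {poly R})%R < 3)%N.
  apply: leq_ltn_trans (size_polyMleq _ _) _.
  by rewrite size_polyX size_polyC; case: eqP.
apply/val_inj; rewrite [RHS]poly_of_qpolyD poly_of_qpolyM.
rewrite qpolyXE ?size_polyXn ?monicXn // rmodp_small; last by rewrite [X in (_ < X)%N]h2.
apply/polyP => k; rewrite coefD coefXM !qpolyCE !coefC.
case: k => [|[|k]] /=; rewrite ?addr0 ?add0r //.
by rewrite nth_default // (leq_trans sM).
Qed.

(* Used both over the reals (core inverse) and over the dual numbers (dual core
   generalized inverse). *)
Definition is_core_inverse (K : comNzRingType) (n : nat) (A X : 'M[K]_n) : Prop :=
  [/\ A *m X *m A = A, A *m X ^+ 2 = X & (A *m X)^T = A *m X].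

Definition is_group_inverse (R : realType) (n : nat) (A X : 'M[R]_n) : Prop :=
  [/\ A *m X *m A = A, X *m A *m X = X & A *m X = X *m A].

Definition is_MP_inverse (R : realType) (n : nat) (A X : 'M[R]_n) : Prop :=
  [/\ A *m X *m A = A, X *m A *m X = X,
      (A *m X)^T = A *m X & (X *m A)^T = X *m A].

(* In each case at most one such matrix exists; the value 0 is a junk default
   when there is none, which cannot happen for the Moore-Penrose inverse, nor
   for the other two when index1 A holds. *)
Definition group_inv (R : realType) (n : nat) (A : 'M[R]_n) : 'M[R]_n :=
  xget 0 [set X | is_group_inverse A X]%classic.

Definition MP_inv (R : realType) (n : nat) (A : 'M[R]_n) : 'M[R]_n :=
  xget 0 [set X | is_MP_inverse A X]%classic.

Definition core_inv (R : realType) (n : nat) (A : 'M[R]_n) : 'M[R]_n :=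
  xget 0 [set X | is_core_inverse A X]%classic.

Definition index1 (R : realType) (n : nat) (A : 'M[R]_n) : Prop :=
  \rank (A ^+ 2) = \rank A.

(* Main.v *)
Require Import Defs.
From mathcomp Require Import all_boot all_order all_algebra.
From mathcomp Require Import classical_sets reals.

(** Every condition amounts to: [Ind(A) = 1] and [B = A P + Q A] for
    some real [P], [Q].  For any inner inverse [G] of [A], the equation
    [B G A + A X A + A G B = B] is consistent iff [(1 - A G) B (1 - G A) = 0],
    and this holds iff [B] has that form, whatever [G] is.  The real part of
    the equations of a core inverse [G + eps H] of [A + eps B] forces
    [Ind(A) = 1], and the dual part of the first one is the equation itself
    with [X = H].  Conversely, with [G] the core inverse of [A] and
    [E = A G], the candidate for [(A + eps B)(G + eps H)] is the orthogonal
    projection [E + eps (K + K^T)], where [K = (1 - E) B G], and one solves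
    for [H]. *)

Set Implicit Arguments.
Unset Strict Implicit.
Unset Printing Implicit Defensive.

Import GRing.Theory Num.Theory.
Import Pdiv.CommonRing.
Local Open Scope ring_scope.

Section DualMatrix.
Variables (R : realType) (n : nat).
Implicit Types A B C D : 'M[R]_n.

Lemma dual_mx_coef A B i j :
  ((dual_mx A B i j)`_0 = A i j) * ((dual_mx A B i j)`_1 = B i j).
Proof.
have h2 : size (mk_monic ('X^2 : {poly R})) = 3%N.
  by rewrite mk_monic_Xn size_polyXn.
have sXb : (size ('X * (B i j)%:P : {poly R})%R < 3)%N.
  apply: leq_ltn_trans (size_polyMleq _ _) _.
  by rewrite size_polyX size_polyC; case: eqP.
rewrite !mxE poly_of_qpolyD poly_of_qpolyM.
rewrite qpolyXE ?size_polyXn ?monicXn // rmodp_small; last first.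
  by rewrite [X in (_ < X)%N]h2.
by rewrite !coefD !coefXM !qpolyCE !coefC /= addr0 add0r.
Qed.

Lemma dual_mx_inj A B C D : dual_mx A B = dual_mx C D -> A = C /\ B = D.
Proof.
move=> e; split; apply/matrixP => i j.
  by rewrite -(dual_mx_coef A B i j).1 e dual_mx_coef.
by rewrite -(dual_mx_coef A B i j).2 e dual_mx_coef.
Qed.

Lemma mulmx_dual A B C D :
  dual_mx A B *m dual_mx C D = dual_mx (A *m C) (A *m D + B *m C).
Proof.
rewrite /dual_mx mulmxDl !mulmxDr -!scalemxAl -!scalemxAr scalerA -expr2.
by rewrite dual_eps_sqr scale0r addr0 map_mxD !map_mxM scalerDr addrA.
Qed.

Lemma tr_dual_mx A B : (dual_mx A B)^T = dual_mx A^T B^T.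
Proof. by rewrite /dual_mx linearD linearZ /= !map_trmx. Qed.

End DualMatrix.

Section GeneralizedInverses.
Variables (R : realType) (n : nat).
Implicit Types A B G X Y Z : 'M[R]_n.

(** The rank lost from [A^T] to [A^T *m A] is that of [K], the part of the row space of [A^T] killed
    by [A]. There [K *m K^T = 0], and over the reals a vanishing sum of squares forces [K = 0]. *)
Lemma submx_gram A : (A <= A^T *m A)%MS.
Proof.
have sub : (A^T *m A <= A)%MS by apply: submxMl.
have -> : (A <= A^T *m A)%MS = (\rank A <= \rank (A^T *m A))%N.
  by rewrite (geq_leqif (mxrank_leqif_sup sub)).
have sq0 m p (M : 'M[R]_(m, p)) : M *m M^T = 0 -> M = 0.
  move=> MM0; apply/matrixP => i j; rewrite mxE; apply/eqP.
  have /eqP := congr1 (fun N : 'M_m => N i i) MM0.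
  rewrite !mxE psumr_eq0 => [/allP/(_ j)|k _]; rewrite !mxE -?expr2 ?sqr_ge0//.
  by rewrite mem_index_enum sqrf_eq0; apply.
rewrite -(mxrank_tr A) -[leqLHS](mxrank_mul_ker _ A).
rewrite -[leqRHS]addn0 leq_add2l leqn0 mxrank_eq0; apply/eqP.
set K := (_ :&: _)%MS.
have /submxP[D DK] : (K <= A^T)%MS by apply: capmxSl.
have KA : K *m A = 0 by apply/sub_kermxP; apply: capmxSr.
by apply: sq0; rewrite {2}DK trmx_mul trmxK mulmxA KA mul0mx.
Qed.

Lemma ex_inner_inverse3 A :
  exists X, A *m X *m A = A /\ (A *m X)^T = A *m X.
Proof.
have /submxP[Y defA] := submx_gram A.
have tA : A^T = A^T *m A *m Y^T by rewrite {1}defA !trmx_mul trmxK.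
have symAY : (A *m Y^T)^T = A *m Y^T.
  (* A matrix with [S^T = S^T *m S] is symmetric, because the right-hand side is. *)
  have e : (A *m Y^T)^T = (A *m Y^T)^T *m (A *m Y^T).
    by rewrite trmx_mul trmxK {1}tA !mulmxA.
  move: (A *m Y^T) e => S e.
  by rewrite -[RHS]trmxK [in RHS]e trmx_mul trmxK -e.
by exists Y^T; split=> //; rewrite -symAY trmx_mul trmxK -mulmxA -defA.
Qed.

Lemma ex_MP_inverse A : exists X, is_MP_inverse A X.
Proof.
have [X [AXA symAX]] := ex_inner_inverse3 A.
have [Y [AYA symAY]] := ex_inner_inverse3 A^T.
have {}AYA : A *m Y^T *m A = A by rewrite -[RHS]trmxK -AYA !trmx_mul !trmxK mulmxA.
have {}symAY : (Y^T *m A)^T = Y^T *m A.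
  by rewrite trmx_mul trmxK -[RHS]trmxK trmx_mul trmxK symAY.
have AZ : A *m (Y^T *m A *m X) = A *m X by rewrite !mulmxA AYA.
have ZA : Y^T *m A *m X *m A = Y^T *m A by rewrite -!mulmxA (mulmxA A X) AXA.
(* [X] makes [A *m X] symmetric and [Y^T] makes [Y^T *m A] symmetric; this product keeps both
   projections. *)
exists (Y^T *m A *m X); split; rewrite ?AZ ?ZA //.
by rewrite !mulmxA -!(mulmxA Y^T) AYA.
Qed.

Lemma index1P A :
  index1 A <-> exists Z, A = A *m A *m Z.
Proof.
rewrite /index1 expr2 -mulmxE; split=> [rA|[Z defA]]; last first.
  by apply/eqP; rewrite eqn_leq mxrankM_maxl {1}defA mxrankM_maxl.
(* Transposed because [<=] compares row spaces, while the claim concerns column spaces. *)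
have : (A^T <= A^T *m A^T)%MS.
  by rewrite -(geq_leqif (mxrank_leqif_sup (submxMl _ _))) -trmx_mul !mxrank_tr rA.
by case/submxP=> D /(congr1 trmx); rewrite !trmx_mul !trmxK; exists D^T.
Qed.

(** Equal ranks give both [A = A *m A *m Z] and [A = Y *m (A *m A)], whence [Y *m A = A *m Z]; the
    group inverse is [Y *m A *m Z]. *)
Lemma ex_group_inverse A : index1 A -> exists X, is_group_inverse A X.
Proof.
move=> iA; have [Z AZ] := (index1P A).1 iA.
have [Y AY] : exists Y, A = Y *m (A *m A).
  apply/submxP; rewrite -(geq_leqif (mxrank_leqif_sup (submxMl _ _))).
  by move: iA; rewrite /index1 expr2 -mulmxE => ->.
have YAE : Y *m A = A *m Z by rewrite {1}AZ !mulmxA -(mulmxA Y) -AY.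
have AX : A *m (Y *m A *m Z) = A *m Z by rewrite YAE !mulmxA -AZ.
have XA : Y *m A *m Z *m A = A *m Z.
  by rewrite -(mulmxA Y) -YAE -!mulmxA -AY.
have AZA : A *m Z *m A = A by rewrite -YAE -mulmxA -AY.
exists (Y *m A *m Z); split; rewrite ?AX ?XA //.
by rewrite YAE !mulmxA AZA.
Qed.

Lemma ex_core_inverse A : index1 A -> exists X, is_core_inverse A X.
Proof.
case/ex_group_inverse=> Z [AZA ZAZ AZ].
have [X [AXA symAX]] := ex_inner_inverse3 A.
have AC : A *m (Z *m A *m X) = A *m X by rewrite !mulmxA AZA.
exists (Z *m A *m X); split; rewrite ?AC //.
by rewrite expr2 -mulmxE mulmxA AC -AZ !mulmxA AXA.
Qed.

(** Serves to get [K *m E = K] in the dual construction. *)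
Lemma core_inverse_outer A G : index1 A -> is_core_inverse A G ->
  G *m A *m G = G.
Proof.
case/ex_group_inverse=> Z [AZA _ AZ] [AGA].
rewrite expr2 -mulmxE => AGG _.
have ZAA : Z *m A *m A = A by rewrite -AZ.
(* G = A G^2 has its range in that of A, on which Z A is the identity. *)
have ZAG : Z *m A *m G = G by rewrite -{1}AGG !mulmxA ZAA -mulmxA.
have GAA : G *m A *m A = A.
  by rewrite -{1}ZAG -[RHS]ZAA -!mulmxA !(mulmxA A G) (mulmxA (A *m G)) AGA.
by rewrite -{2}AGG !mulmxA GAA -mulmxA.
Qed.

Lemma MP_invP A : is_MP_inverse A (MP_inv A).
Proof. by have [X AX] := ex_MP_inverse A; apply: (xgetPex 0 (ex_intro _ X AX)). Qed.

Lemma group_invP A : index1 A -> is_group_inverse A (group_inv A).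
Proof. by case/ex_group_inverse=> X AX; apply: (xgetPex 0 (ex_intro _ X AX)). Qed.

Lemma core_invP A : index1 A -> is_core_inverse A (core_inv A).
Proof. by case/ex_core_inverse=> X AX; apply: (xgetPex 0 (ex_intro _ X AX)). Qed.

(** The last equation is [(1 - A G) B (1 - G A) = 0] expanded: the left factor kills [A P], the
    right one kills [Q A]. *)
Lemma inner_inverse_decomp A B G : A *m G *m A = A ->
  (exists P Q, B = A *m P + Q *m A) <->
  B = B *m G *m A - A *m G *m B *m G *m A + A *m G *m B.
Proof.
move=> AGA; split=> [[P [Q ->]]|defB]; last first.
  exists (G *m B), (B *m G - A *m G *m B *m G).
  by rewrite mulmxBl addrC !mulmxA.
have defAGB : A *m G *m (A *m P + Q *m A) = A *m P + A *m G *m Q *m A.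
  by rewrite mulmxDr !mulmxA AGA.
have defBGA M : (M + Q *m A) *m G *m A = M *m G *m A + Q *m A.
  by rewrite !mulmxDl -!(mulmxA Q) AGA.
rewrite defAGB defBGA !mulmxDl -!(mulmxA (A *m G *m Q)) AGA.
rewrite opprD (addrACA (A *m P *m G *m A)) subrr add0r [RHS]addrC -addrA.
by rewrite (addrC (A *m G *m Q *m A)) subrK.
Qed.

Lemma consistentP A B G : A *m G *m A = A ->
  (exists X, B *m G *m A + A *m X *m A + A *m G *m B = B) <->
  (exists P Q, B = A *m P + Q *m A).
Proof.
move=> AGA; split=> [[X defB]|].
  exists (G *m B), (B *m G + A *m X).
  by rewrite mulmxDl addrC !mulmxA defB.
move/(inner_inverse_decomp _ AGA) => defB.
(* This [X] removes [A G B G A], which the two outer terms count twice. *)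
by exists (- (G *m B *m G)); rewrite mulmxN mulNmx !mulmxA -defB.
Qed.

End GeneralizedInverses.

Section DualCoreInverse.
Variables (R : realType) (n : nat).
Implicit Types A B : 'M[R]_n.

Lemma dual_core_inverse_necessary A B (Gd : 'M[dual R]_n) :
  is_core_inverse (dual_mx A B) Gd ->
  index1 A /\ exists P Q, B = A *m P + Q *m A.
Proof.
have [G [H ->]] := dual_mx_surj Gd.
rewrite /is_core_inverse (expr2 (dual_mx G H)) -mulmxE !mulmx_dual.
case=> /dual_mx_inj[AGA defB] /dual_mx_inj[AGG _] _; split.
  (* [A = A G A = A (A G G) A]. *)
  by apply/index1P; exists (G *m G *m A); rewrite -{1}AGA -{1}AGG !mulmxA.
exists (G *m B), (A *m H + B *m G).
by rewrite mulmxA defB.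
Qed.

Lemma dual_core_inverse_sufficient A B :
  index1 A -> (exists P Q, B = A *m P + Q *m A) ->
  exists Gd : 'M[dual R]_n, is_core_inverse (dual_mx A B) Gd.
Proof.
move=> iA; have GP := core_invP iA; move: (GP) => [].
set G := core_inv A; rewrite expr2 -mulmxE => AGA AGG symAG.
move/(inner_inverse_decomp _ AGA) => defB.
have [E defE] : exists E, A *m G = E by exists (A *m G).
rewrite defE in symAG.
have EA : E *m A = A by rewrite -defE.
have EG : E *m G = G by rewrite -defE -mulmxA.
have EE : E *m E = E by rewrite -{2}defE mulmxA EA.
(* If [E + eps L] is to fix [A + eps B] from the left, then [L A = (1 - E) B], so
   [L E = (1 - E) B G], which is [K]. Adding [K^T] makes [L] symmetric. *)
have [K defK] : exists K, K = (1%:M - E) *m B *m G by eexists.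
have EK : E *m K = 0 by rewrite defK !mulmxA mulmxBr mulmx1 EE subrr !mul0mx.
have KE : K *m E = K.
  by rewrite defK -defE -!mulmxA (mulmxA G A G) (core_inverse_outer iA GP).
have EKt : E *m K^T = K^T by rewrite -{1}symAG -trmx_mul KE.
have KtE : K^T *m E = 0 by rewrite -{1}symAG -trmx_mul EK trmx0.
have KtA : K^T *m A = 0 by rewrite -EA mulmxA KtE mul0mx.
have KtG : K^T *m G = 0 by rewrite -EG mulmxA KtE mul0mx.
(* The second equation requires [(1 - E) H = K G], so [H] is [K G] plus a term [G W] in the range of
   [E]. Since [A G W = E W = W], solving [A H + B G = K + K^T] gives this [W]. *)
pose W := K^T - E *m B *m G - A *m K *m G.
have EW : E *m W = W by rewrite /W !mulmxBr !mulmxA EKt EE EA.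
pose H := G *m W + K *m G.
have AH : A *m H + B *m G = K + K^T.
  rewrite /H mulmxDr !mulmxA defE EW /W subrK defK -[B in LHS]mul1mx.
  by rewrite !mulmxBl !mul1mx addrAC -addrA addrC.
have AdGd : dual_mx A B *m dual_mx G H = dual_mx E (K + K^T).
  by rewrite mulmx_dual defE AH.
exists (dual_mx G H); split.
- rewrite AdGd mulmx_dual EA mulmxDl KtA addr0 defK; congr dual_mx.
  by rewrite [RHS]defB defE !mulmxBl mul1mx addrC.
- rewrite (expr2 (dual_mx G H)) -mulmxE mulmxA AdGd mulmx_dual EG; congr dual_mx.
  by rewrite mulmxDl KtG addr0 /H mulmxDr !mulmxA EG EK mul0mx addr0.
- by rewrite AdGd tr_dual_mx symAG linearD /= trmxK addrC.
Qed.

End DualCoreInverse.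

Theorem theorem3p6 (R : realType) (n : nat) (A B : 'M[R]_n) :
  [<-> exists G : 'M[dual R]_n, is_core_inverse (dual_mx A B) G;
       index1 A /\ exists X : 'M[R]_n,
         B *m group_inv A *m A + A *m X *m A + A *m group_inv A *m B = B;
       index1 A /\ exists X : 'M[R]_n,
         B *m MP_inv A *m A + A *m X *m A + A *m MP_inv A *m B = B;
       index1 A /\ exists X : 'M[R]_n,
         B *m core_inv A *m A + A *m X *m A + A *m core_inv A *m B = B].
Proof.
have [AMA _ _ _] := MP_invP A.
(* [Ind(A) = 1] makes [group_inv A] and [core_inv A] genuine inverses rather than the default 0;
   [MP_inv A] always is one. *)
tfae.
- case=> Gd /dual_core_inverse_necessary[iA PQ]; split=> //.
  by have [AGA _ _] := group_invP iA; apply/consistentP.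
- case=> iA AX; split=> //; have [AGA _ _] := group_invP iA.
  by apply/(consistentP _ AMA)/(consistentP _ AGA).
- case=> iA AX; split=> //; have [ACA _ _] := core_invP iA.
  by apply/(consistentP _ ACA)/(consistentP _ AMA).
case=> iA AX; have [ACA _ _] := core_invP iA.
by apply: dual_core_inverse_sufficient => //; apply/(consistentP _ ACA).
Qed.
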